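(* For every fixed $t\in\mathbb{N}$ and $\varepsilon>0$ there is an integer $d=d(t,\varepsilon)$ such that, for every $0/1$ packing problem given by a matrix $A\in\mathbb{R}_+^{m\times n}$ and a vector $b\in\mathbb{R}_+^m$ (with $m,n$ arbitrary), $$opt_d(c)\ \le\ (1+\varepsilon)\,opt^{(t)}(c)\qquad\text{for all } c\in\mathbb{R}_+^n,$$ where $opt^{(t)}(c)=\max\{c^\top x:x\in P^{(t)}\}$ with $P^{(t)}$ the $t$-th Chvátal-Gomory closure of $P=\{x\in\mathbb{R}^n:0\le x_i\le1\ \forall i\in\{1,\dots,n\},\ Ax\le b\}$, and $opt_d(c)=\max\{c^\top x:x\in Sol(d)\}$ with $Sol(d)$ the set of feasible solutions of the $d$-SoS relaxation of $\mathcal{F}_{A,b}=\{x\in\mathbb{R}^n:x_i^2-x_i=0\ \forall i,\ Ax\le b\}$, projected to the original variables.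
   Context: **Chvátal-Gomory closures.** $P^{(0)}:=P$. For $t\ge1$, $P^{(t)}$ is the CG closure of $P^{(t-1)}$: the set of all $x\in P^{(t-1)}$ satisfying $a^\top x\le\lfloor a_0\rfloor$ for every $a\in\mathbb{Z}^n$ and $a_0\in\mathbb{R}$ such that $a^\top x\le a_0$ is valid for $P^{(t-1)}$. **$d$-SoS relaxation and $Sol(d)$.** For $p\in\mathbb{R}[x_1,\dots,x_n]$, $\overline{p}$ is its multilinear form (replace each $x_i^k$, $k\ge2$, by $x_i$). Let $\mathcal{S}$ be the set of all multilinear monomials of degree at most $d$, with span $\langle\mathcal{S}\rangle$; put $x_0:=1$ and $T:=\{\overline{x_i p q}:p,q\in\mathcal{S},\ 0\le i\le n\}$. The feasible solutions of the $d$-SoS relaxation of $\mathcal{F}_{A,b}$ are the linear functionals $y:\langle T\rangle\to\mathbb{R}$ such that $y[1]=1$, $y[\overline{q^2}]\ge0$ and $y[\overline{q^2g}]\ge0$ for all $q\in\langle\mathcal{S}\rangle$ and every constraint $g\ge0$, where the constraints are the rows of $b-Ax\ge0$ together with $x_i\ge0$ for $i\in\{1,\dots,n\}$. $Sol(d)$ is the set of all vectors $(y[x_1],\dots,y[x_n])$ for feasible $y$. *)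

(* Defs.v *)
From mathcomp Require Import all_boot all_order all_algebra.
From mathcomp Require Import archimedean.
From mathcomp Require Import boolp classical_sets reals.
From mathcomp Require Import mpoly.

Set Implicit Arguments.
Unset Strict Implicit.
Unset Printing Implicit Defensive.

Import Order.TTheory GRing.Theory Num.Theory.

Local Open Scope classical_set_scope.
Local Open Scope ring_scope.

Definition dot (R : realType) (n : nat) (c x : 'cV[R]_n) : R :=
  \sum_i c i 0 * x i 0.

(* [v] is the attained maximum of the objective [c] over [X]. *)
Definition is_opt (R : realType) (n : nat) (X : set 'cV[R]_n) (c : 'cV[R]_n)
    (v : R) : Prop :=
  [set dot c x | x in X] v /\ ubound [set dot c x | x in X] v.

Definition lp_relaxation (R : realType) (m n : nat) (A : 'M[R]_(m, n))
    (b : 'cV[R]_m) : set 'cV[R]_n :=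
  [set x : 'cV[R]_n | (forall i, 0 <= x i 0 <= 1) /\
           (forall j, (A *m x) j 0 <= b j 0)].

Definition cg_closure (R : realType) (n : nat) (P : set 'cV[R]_n) :
    set 'cV[R]_n :=
  [set x : 'cV[R]_n | P x /\
     forall (a : 'cV[int]_n) (a0 : R),
       (forall z, P z -> dot (map_mx intr a) z <= a0) ->
       dot (map_mx intr a) x <= (Num.floor a0)%:~R].

Definition cg_closure_iter (R : realType) (n : nat) (t : nat)
    (P : set 'cV[R]_n) : set 'cV[R]_n :=
  iter t (@cg_closure R n) P.

Definition multilinear_form (R : realType) (n : nat) (p : {mpoly R[n]}) :
    {mpoly R[n]} :=
  \sum_(mu <- msupp p) p@_mu *: 'X_[[multinom minn (mu i) 1%N | i < n]].

Definition mlmonomials (R : realType) (n d : nat) : set {mpoly R[n]} :=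
  [set 'X_[mu] | mu in [set mu : 'X_{1..n} |
     (forall i, (mu i <= 1)%N) /\ (mdeg mu <= d)%N]].

Definition lin_span (R : realType) (V : lmodType R) (T : set V) : set V :=
  [set v | exists (k : nat) (a : 'I_k -> R) (u : 'I_k -> V),
     (forall i, T (u i)) /\ v = \sum_i a i *: u i].

(* The variables indexed by 0..n, where index 0 stands for the constant 1. *)
Definition var0 (R : realType) (n : nat) (i : 'I_n.+1) : {mpoly R[n]} :=
  if unlift ord0 i is Some j then 'X_j else 1.

Definition sos_T (R : realType) (n d : nat) : set {mpoly R[n]} :=
  [set r | exists (i : 'I_n.+1) (p q : {mpoly R[n]}),
     [/\ mlmonomials d p, mlmonomials d q
       & r = multilinear_form (var0 R i * p * q)]].

Definition constraints (R : realType) (m n : nat) (A : 'M[R]_(m, n))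
    (b : 'cV[R]_m) : set {mpoly R[n]} :=
  [set g | (exists j, g = (b j 0)%:MP - \sum_i A j i *: 'X_i) \/
           (exists i, g = 'X_i)].

Definition linear_on (R : realType) (V : lmodType R) (U : set V)
    (y : V -> R) : Prop :=
  forall (a : R) (u v : V), U u -> U v -> y (a *: u + v) = a * y u + y v.

(* A functional on the span of [sos_T] is represented by a function on all
   polynomials that is linear on that span; its values elsewhere are arbitrary
   and never used. *)
Definition sos_feasible (R : realType) (m n d : nat) (A : 'M[R]_(m, n))
    (b : 'cV[R]_m) (y : {mpoly R[n]} -> R) : Prop :=
  [/\ linear_on (lin_span (@sos_T R n d)) y,
      y 1 = 1,
      forall q, lin_span (mlmonomials d) q ->
        0 <= y (multilinear_form (q ^+ 2))
    & forall q g, lin_span (mlmonomials d) q -> constraints A b g ->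
        0 <= y (multilinear_form (q ^+ 2 * g))].

Definition Sol (R : realType) (m n d : nat) (A : 'M[R]_(m, n))
    (b : 'cV[R]_m) : set 'cV[R]_n :=
  [set \col_i y 'X_i | y in sos_feasible d A b].

(* Main.v *)
From HB Require Import structures.
Require Import Defs.
From mathcomp Require Import all_boot all_order all_algebra.
From mathcomp Require Import boolp reals.
From mathcomp Require Import ring lra zify.
From mathcomp Require classical_sets topology normedtype mpoly.

(** A point of the [d]-SoS relaxation is a vector of pseudo-moments
    [y S], one for each small set [S] of variables, where [y S] plays the role
    of the expectation of the product of the [x_i] with [i] in [S] ([SolP]).
    The scaled inclusion proved by induction on [t] is: for every [delta > 0]
    and all large [d], each [x] in [Sol d A b] satisfies
    [x / (1 + delta) \in P^(t)] ([moments_scaled_cg]).  The bound on the optima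
    is then immediate, by scaling an optimal point of [Sol d A b].

    Consider in the inductive step a cut [a x <= floor a0], where [a x <= a0] is
    valid for [P^(t)].  As [P] is a packing polytope, [P^(t)] is down-closed
    ([cg_closure_iter_down_closed]), so that one may replace [a] by its positive
    part.  Two regimes remain.

    If [floor a0] is at least a constant [K] depending on [delta], rounding down
    loses only a factor [1 + 1/K], and that loss is absorbed by applying the
    induction hypothesis with [delta / 2].

    If [f = floor a0 < K], every 0/1 point [S] of [P] lies in [P^(t)], so it
    satisfies [a(S) <= f] and therefore has at most [f] ones in the support of
    [a].  Pseudo-moments of infeasible sets vanish ([moment_infeasible]), hence on
    the support of [a] only a down-closed family of sets with at most [f] elements
    has nonzero moments, and the unions of two of them are within reach of the
    relaxation as soon as [d > 2 f].  Moebius inversion turns such a positive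
    semidefinite family into an honest nonnegative measure on feasible sets
    ([psd_down_closed_measure]).  Averaging [a(S) <= f] over this measure gives
    [a x <= f] with no loss at all ([moment_small_rank]).  This is why the dependence on [t] is only through
    the number of times that [delta] has been halved.

    That both maxima are attained is a compactness argument: a closed and
    pointwise bounded set of real functions is compact ([max_attained]), which
    applies to [P^(t)] and, once the moments that the relaxation never mentions
    are set to zero ([moment_feasible_bounded]), to the pseudo-moments. *)

Set Implicit Arguments.
Unset Strict Implicit.
Unset Printing Implicit Defensive.

Import Order.TTheory GRing.Theory Num.Theory.

Local Open Scope ring_scope.

(** * Pseudo-moments *)

(** The value at [q ^+ 2], for [q] with coefficients [alpha], of the functional
    with pseudo-moments [y]: monomials multiply by taking unions. *)
Definition moment_form (R : realType) (n d : nat) (m alpha : {set 'I_n} -> R) : R :=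
  \sum_(U : {set 'I_n} | (#|U| <= d)%N) \sum_(V : {set 'I_n} | (#|V| <= d)%N)
    alpha U * alpha V * m (U :|: V).

(** Multiplying a polynomial by the variable [i] shifts its pseudo-moments by
    [i |: _]; the last two clauses are therefore the constraints at a square times
    a variable and at a square times a row. *)
Definition moment_feasible (R : realType) (m n d : nat) (A : 'M[R]_(m, n))
    (b : 'cV[R]_m) (y : {set 'I_n} -> R) : Prop :=
  [/\ y set0 = 1,
      forall alpha, 0 <= moment_form d y alpha,
      forall i alpha, 0 <= moment_form d (fun S => y (i |: S)) alpha
    & forall j alpha, 0 <= moment_form d
        (fun S => b j 0 * y S - \sum_i A j i * y (i |: S)) alpha].

Lemma eq_moment_form (R : realType) (n d : nat) (y z alpha : {set 'I_n} -> R) :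
  y =1 z -> moment_form d y alpha = moment_form d z alpha.
Proof. by move=> yz; apply: eq_bigr => U _; apply: eq_bigr => V _; rewrite yz. Qed.

(** * Linear functionals on a span *)

Section Span.
Variables (R : realType) (V : lmodType R) (T : classical_sets.set V).

Lemma mem_lin_span v : T v -> lin_span T v.
Proof.
move=> Tv; exists 1%N, (fun=> 1), (fun=> v); split=> //.
by rewrite big_ord1 scale1r.
Qed.

Lemma lin_span0 : lin_span T 0.
Proof. by exists 0%N, (fun=> 0), (fun=> 0); split=> [[]//|]; rewrite big_ord0. Qed.

Lemma lin_span_linear a u v : lin_span T u -> lin_span T v -> lin_span T (a *: u + v).
Proof.
move=> [k [c [w [Tw ->]]]] [l [e [x [Tx ->]]]].
exists (k + l)%N,
  (fun i => match split i with inl j => a * c j | inr j => e j end),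
  (fun i => match split i with inl j => w j | inr j => x j end).
split=> [i|]; first by case: split.
rewrite big_split_ord scaler_sumr; congr (_ + _); apply: eq_bigr => i _ /=.
  by rewrite (unsplitK (inl i)) scalerA.
by rewrite (unsplitK (inr i)).
Qed.

Lemma lin_spanD u v : lin_span T u -> lin_span T v -> lin_span T (u + v).
Proof. by move=> Tu; rewrite -[u]scale1r; apply: lin_span_linear. Qed.

Lemma lin_spanZ a u : lin_span T u -> lin_span T (a *: u).
Proof. by move=> Tu; rewrite -[_ *: u]addr0; apply: lin_span_linear Tu lin_span0. Qed.

Lemma lin_span_sum (I : Type) (r : seq I) (P : pred I) (F : I -> V) :
  (forall i, P i -> lin_span T (F i)) -> lin_span T (\sum_(i <- r | P i) F i).
Proof. by move=> TF; apply: big_ind TF; [apply: lin_span0 | apply: lin_spanD]. Qed.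

Variable y : V -> R.
Hypothesis y_lin : linear_on (lin_span T) y.

Lemma linear_on0 : y 0 = 0.
Proof.
by have := y_lin (-1) lin_span0 lin_span0; rewrite scaler0 addr0 mulN1r addNr.
Qed.

Lemma linear_onD u v : lin_span T u -> lin_span T v -> y (u + v) = y u + y v.
Proof. by move=> Tu Tv; rewrite -[u in LHS]scale1r y_lin ?mul1r. Qed.

Lemma linear_onZ a u : lin_span T u -> y (a *: u) = a * y u.
Proof.
by move=> Tu; rewrite -[_ *: u]addr0 y_lin ?linear_on0 ?addr0//; apply: lin_span0.
Qed.

Lemma linear_on_sum (I : Type) (r : seq I) (P : pred I) (F : I -> V) :
  (forall i, P i -> lin_span T (F i)) ->
  y (\sum_(i <- r | P i) F i) = \sum_(i <- r | P i) y (F i).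
Proof.
move=> TF; elim: r => [|i r IHr]; first by rewrite !big_nil linear_on0.
rewrite !big_cons; case: ifP => // Pi.
by rewrite linear_onD ?IHr//; [apply: TF | apply: lin_span_sum].
Qed.
End Span.

(** * Multilinear monomials *)

Section Poly.
Import mpoly.
Variables (R : realType) (n : nat).
Implicit Types (S U V : {set 'I_n}) (p q : {mpoly R[n]}) (d : nat).

Definition set_mnm S : 'X_{1..n} := [multinom (i \in S : nat) | i < n].
Definition mnm_supp (mu : 'X_{1..n}) : {set 'I_n} := [set i | mu i != 0%N].
Definition set_mon S : {mpoly R[n]} := 'X_[set_mnm S].

Lemma set_mnmK : cancel set_mnm mnm_supp.
Proof. by move=> S; apply/setP=> i; rewrite inE mnmE; case: (i \in S). Qed.

Lemma mdeg_set_mnm S : mdeg (set_mnm S) = #|S|.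
Proof.
rewrite mdegE -sum1_card [RHS]big_mkcond /=.
by apply: eq_bigr => i _; rewrite mnmE; case: (i \in S).
Qed.

Lemma set_mon0 : set_mon set0 = 1.
Proof. by rewrite /set_mon -mpolyX0; congr 'X_[_]; apply/mnmP=> i; rewrite !mnmE inE. Qed.

Lemma set_mon1 i : set_mon [set i] = 'X_i.
Proof.
rewrite /set_mon; congr 'X_[_]; apply/mnmP=> j; rewrite !mnmE inE.
by rewrite eq_sym; case: eqP.
Qed.

Lemma mlmonomialsP d p :
  mlmonomials d p <-> exists2 S : {set 'I_n}, (#|S| <= d)%N & p = set_mon S.
Proof.
split=> [[mu [mu1 mud] <-]|[S Sd ->]].
  have E : mu = set_mnm (mnm_supp mu).
    by apply/mnmP=> i; rewrite mnmE inE; case: (mu i) (mu1 i) => [|[]].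
  by exists (mnm_supp mu); [rewrite -mdeg_set_mnm -E | rewrite /set_mon -E].
exists (set_mnm S) => //; split; last by rewrite mdeg_set_mnm.
by move=> i; rewrite mnmE; case: (_ \in _).
Qed.

(** Summing over all monomials of bounded degree, rather than over the support of
    the polynomial, makes linearity visible. *)
Lemma multilinear_formE p k : (msize p <= k)%N ->
  multilinear_form p = \sum_(mu : 'X_{1..n < k}) p@_mu *: set_mon (mnm_supp mu).
Proof.
move=> le_pk.
have E (mu : 'X_{1..n}) : [multinom minn (mu i) 1 | i < n] = set_mnm (mnm_supp mu).
  by apply/mnmP=> i; rewrite !mnmE inE; case: (mu i) => [|[|?]]; rewrite ?minn0.
rewrite /multilinear_form; under eq_bigr do rewrite E.
rewrite (ssrcomplements.big_mksub 'X_{1..n < k}) ?msupp_uniq //=; first last.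
  by move=> mu /msize_mdeg_lt /leq_trans; apply.
by rewrite big_rmcond //= => mu; move/memN_msupp_eq0 ->; rewrite scale0r.
Qed.

Lemma multilinear_form_is_linear : linear (@multilinear_form R n).
Proof.
move=> a p q; pose k := maxn (msize (a *: p + q)) (maxn (msize p) (msize q)).
rewrite !(@multilinear_formE _ k) ?leq_max ?leqnn ?orbT //.
rewrite scaler_sumr -big_split; apply: eq_bigr => mu _ /=.
by rewrite mcoeffD mcoeffZ scalerDl scalerA.
Qed.
HB.instance Definition _ := GRing.isLinear.Build R {mpoly R[n]} {mpoly R[n]} _
  (@multilinear_form R n) multilinear_form_is_linear.

Lemma multilinear_formX mu :
  multilinear_form ('X_[mu] : {mpoly R[n]}) = set_mon (mnm_supp mu).
Proof.
rewrite /multilinear_form msuppX big_seq1 mcoeffX eqxx scale1r; congr 'X_[_].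
by apply/mnmP=> i; rewrite !mnmE inE; case: (mu i) => [|[|?]]; rewrite ?minn0.
Qed.

Lemma multilinear_form_setM U V :
  multilinear_form (set_mon U * set_mon V) = set_mon (U :|: V).
Proof.
rewrite -mpolyXD multilinear_formX; congr set_mon; apply/setP=> i.
by rewrite !inE mnmDE !mnmE; case: (i \in U); case: (i \in V).
Qed.

Lemma multilinear_form_XsetM i U V :
  multilinear_form ('X_i * set_mon U * set_mon V) = set_mon (i |: (U :|: V)).
Proof.
rewrite -set_mon1 -!mpolyXD multilinear_formX; congr set_mon; apply/setP=> j.
by rewrite !inE !mnmDE !mnmE !inE; case: (j == i); case: (j \in U); case: (j \in V).
Qed.
End Poly.

(** * The SoS relaxation as a set of pseudo-moments *)

Section Moments.
Import mpoly.
Variables (R : realType) (n : nat).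
Implicit Types (S U V : {set 'I_n}) (p q : {mpoly R[n]}) (d : nat).

Lemma lin_span_mlmonomials d q : lin_span (@mlmonomials R n d) q ->
  exists alpha : {set 'I_n} -> R,
    q = \sum_(U : {set 'I_n} | (#|U| <= d)%N) alpha U *: set_mon R U.
Proof.
move=> [k [a [u [Tu ->]]]].
exists (fun U => (\sum_i a i *: u i)@_(set_mnm U)).
under [RHS]eq_bigr do rewrite raddf_sum scaler_suml.
rewrite exchange_big; apply: eq_bigr => i _ /=.
have [S Sd ->] := (mlmonomialsP _ _).1 (Tu i).
rewrite (bigD1 S) //= big1 ?addr0 => [|U /andP[_ neUS]].
  by rewrite mcoeffZ mcoeffX eqxx mulr1.
rewrite mcoeffZ mcoeffX (inj_eq (can_inj (@set_mnmK n))) eq_sym.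
by rewrite (negPf neUS) mulr0 scale0r.
Qed.

(** Every SoS constraint is the nonnegativity of a functional at a square times an
    affine polynomial: [1], a variable or a row.  This expansion serves all three. *)
Lemma square_times_affine d (alpha : {set 'I_n} -> R) (g0 : R) (g : 'I_n -> R) :
  let q := \sum_(U : {set 'I_n} | (#|U| <= d)%N) alpha U *: set_mon R U in
  multilinear_form (q ^+ 2 * (g0%:MP + \sum_i g i *: 'X_i)) =
  \sum_(U : {set 'I_n} | (#|U| <= d)%N) \sum_(V : {set 'I_n} | (#|V| <= d)%N)
    (alpha U * alpha V) *:
    (g0 *: set_mon R (U :|: V) + \sum_i g i *: set_mon R (i |: (U :|: V))).
Proof.
move=> q; rewrite expr2 mulr_suml mulr_suml linear_sum; apply: eq_bigr => U _ /=.
rewrite /q mulr_sumr mulr_suml linear_sum; apply: eq_bigr => V _ /=.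
rewrite -!scalerAr -!scalerAl !linearZ /= [_ * (_ + _)]mulrC mulrDl linearD /= scalerA.
rewrite [alpha V * _]mulrC; congr (_ *: (_ + _)).
  by rewrite mul_mpolyC linearZ /= multilinear_form_setM.
rewrite mulr_suml linear_sum; apply: eq_bigr => i _ /=.
by rewrite -scalerAl linearZ /= mulrA multilinear_form_XsetM.
Qed.

Lemma sos_T_setU d U V : (#|U| <= d)%N -> (#|V| <= d)%N ->
  sos_T d (set_mon R (U :|: V)).
Proof.
move=> Ud Vd; exists ord0, (set_mon R U), (set_mon R V); split.
- by apply/mlmonomialsP; exists U.
- by apply/mlmonomialsP; exists V.
- by rewrite /var0 unlift_none mul1r multilinear_form_setM.
Qed.

Lemma sos_T_setU1 d i U V : (#|U| <= d)%N -> (#|V| <= d)%N ->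
  sos_T d (set_mon R (i |: (U :|: V))).
Proof.
move=> Ud Vd; exists (lift ord0 i), (set_mon R U), (set_mon R V); split.
- by apply/mlmonomialsP; exists U.
- by apply/mlmonomialsP; exists V.
- by rewrite /var0 liftK multilinear_form_XsetM.
Qed.

Lemma functional_square_times_affine d (y : {mpoly R[n]} -> R) alpha g0 g :
  linear_on (lin_span (@sos_T R n d)) y ->
  let q := \sum_(U : {set 'I_n} | (#|U| <= d)%N) alpha U *: set_mon R U in
  y (multilinear_form (q ^+ 2 * (g0%:MP + \sum_i g i *: 'X_i))) =
  moment_form d (fun S => g0 * y (set_mon R S) +
     \sum_i g i * y (set_mon R (i |: S))) alpha.
Proof.
move=> ylin q; rewrite square_times_affine.
have span0 U V : (#|U| <= d)%N -> (#|V| <= d)%N ->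
    lin_span (@sos_T R n d) (set_mon R (U :|: V)).
  by move=> Ud Vd; apply/mem_lin_span/sos_T_setU.
have span1 U V : (#|U| <= d)%N -> (#|V| <= d)%N -> forall i,
    lin_span (@sos_T R n d) (g i *: set_mon R (i |: (U :|: V))).
  by move=> Ud Vd i; apply/lin_spanZ/mem_lin_span/sos_T_setU1.
have span2 U V : (#|U| <= d)%N -> (#|V| <= d)%N -> lin_span (@sos_T R n d)
    (g0 *: set_mon R (U :|: V) + \sum_i g i *: set_mon R (i |: (U :|: V))).
  move=> Ud Vd; apply: lin_spanD; first exact/lin_spanZ/span0.
  by apply: lin_span_sum => i _; apply: span1.
rewrite (linear_on_sum ylin) => [|U Ud]; last first.
  by apply: lin_span_sum => V Vd; apply/lin_spanZ/span2.
apply: eq_bigr => U Ud; rewrite (linear_on_sum ylin) => [|V Vd]; last first.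
  exact/lin_spanZ/span2.
apply: eq_bigr => V Vd; rewrite (linear_onZ ylin); last exact: span2.
rewrite (linear_onD ylin); [|exact/lin_spanZ/span0|]; last first.
  by apply: lin_span_sum => i _; apply: span1.
rewrite (linear_onZ ylin); last exact: span0.
rewrite (linear_on_sum ylin) => [|i _]; last exact: span1.
congr (_ * (_ + _)); apply: eq_bigr => i _.
by rewrite (linear_onZ ylin) //; apply/mem_lin_span/sos_T_setU1.
Qed.

Variables (m d : nat) (A : 'M[R]_(m, n)) (b : 'cV[R]_m).

Lemma sos_feasible_moments (y : {mpoly R[n]} -> R) :
  linear_on (lin_span (@sos_T R n d)) y ->
  let z S := y (set_mon R S) in
  (sos_feasible d A b y <-> moment_feasible d A b z).
Proof.
move=> ylin z.
have form0 alpha :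
    let q := \sum_(U : {set 'I_n} | (#|U| <= d)%N) alpha U *: set_mon R U in
    y (multilinear_form (q ^+ 2)) = moment_form d z alpha.
  move=> q; have := functional_square_times_affine alpha 1 (fun=> 0) ylin.
  rewrite /= [X in _ + X]big1 ?addr0 ?mulr1 => [->|i _]; last by rewrite scale0r.
  apply: eq_moment_form => S; rewrite mul1r big1 ?addr0 // => i _.
  by rewrite mul0r.
have form1 alpha i :
    let q := \sum_(U : {set 'I_n} | (#|U| <= d)%N) alpha U *: set_mon R U in
    y (multilinear_form (q ^+ 2 * 'X_i)) =
    moment_form d (fun S => z (i |: S)) alpha.
  move=> q; have := functional_square_times_affine alpha 0 (fun k => (k == i)%:R) ylin.
  rewrite /= add0r (bigD1 i) //= eqxx scale1r [X in _ + X]big1 ?addr0 => [->|k /negPf->].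
    apply: eq_moment_form => S; rewrite mul0r add0r (bigD1 i) //= eqxx mul1r.
    by rewrite big1 ?addr0 // => k /negPf->; rewrite mul0r.
  by rewrite scale0r.
have form2 alpha j :
    let q := \sum_(U : {set 'I_n} | (#|U| <= d)%N) alpha U *: set_mon R U in
    y (multilinear_form (q ^+ 2 * ((b j 0)%:MP - \sum_i A j i *: 'X_i))) =
    moment_form d (fun S => b j 0 * z S - \sum_i A j i * z (i |: S)) alpha.
  move=> q; have := functional_square_times_affine alpha (b j 0) (fun i => - A j i) ylin.
  rewrite (eq_bigr (fun i => - (A j i *: 'X_i))) => [|i _]; last by rewrite scaleNr.
  rewrite sumrN => ->; apply: eq_moment_form => S; congr (_ + _).
  by rewrite -sumrN; apply: eq_bigr => i _; rewrite mulNr.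
have span alpha : lin_span (@mlmonomials R n d)
    (\sum_(U : {set 'I_n} | (#|U| <= d)%N) alpha U *: set_mon R U).
  apply: lin_span_sum => U Ud; apply/lin_spanZ/mem_lin_span.
  by apply/mlmonomialsP; exists U.
split=> [[_ y1 ysq ycon]|[z1 zsq zX zA]]; split=> //.
- by rewrite /z set_mon0.
- by move=> alpha; rewrite -form0; apply/ysq/span.
- by move=> i alpha; rewrite -form1; apply/ycon/(or_intror (ex_intro _ i erefl))/span.
- by move=> j alpha; rewrite -form2; apply/ycon/(or_introl (ex_intro _ j erefl))/span.
- by rewrite -set_mon0.
- by move=> q /lin_span_mlmonomials[alpha ->]; rewrite form0.
- move=> q g /lin_span_mlmonomials[alpha ->] [[j ->]|[i ->]].
    by rewrite form2.
  by rewrite form1.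
Qed.

(** A functional restricts to the monomials; conversely, a vector of moments [z]
    extends to the functional that reads off the coefficients of the multilinear
    monomials, which is linear on all polynomials. *)
Lemma SolP (x : 'cV[R]_n) : Sol d A b x <->
  exists2 y : {set 'I_n} -> R, moment_feasible d A b y & x = \col_i y [set i].
Proof.
split=> [[y yfeas <-]|[z zfeas ->]].
  have ylin : linear_on (lin_span (@sos_T R n d)) y by case: yfeas.
  exists (fun S => y (set_mon R S)); first exact/sos_feasible_moments.
  by apply/matrixP=> i j; rewrite !mxE set_mon1.
pose y p := \sum_(S : {set 'I_n}) p@_(set_mnm S) * z S.
have yE S : y (set_mon R S) = z S.
  rewrite /y (bigD1 S) //= mcoeffX eqxx mul1r big1 ?addr0 // => U neUS.
  rewrite mcoeffX (inj_eq (can_inj (@set_mnmK n))) eq_sym.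
  by rewrite (negPf neUS) mul0r.
have ylin : linear_on (lin_span (@sos_T R n d)) y.
  move=> a u v _ _; rewrite /y mulr_sumr -big_split; apply: eq_bigr => S _ /=.
  by rewrite mcoeffD mcoeffZ mulrDl mulrA.
exists y; last by apply/matrixP=> i j; rewrite !mxE -set_mon1 yE.
apply/(sos_feasible_moments ylin).
by rewrite (_ : (fun S => _) = z) //; apply: funext.
Qed.
End Moments.

(** * Moebius inversion on a down-closed family of sets *)

Section Moebius.
Variables (R : realType) (T : finType).
Implicit Types S U V W : {set T}.

(** Toggling the membership of a fixed element of [W :\: S] pairs the terms of
    opposite signs. *)
Lemma sum_signs_interval S W :
  \sum_(U : {set T} | (S \subset U) && (U \subset W)) (-1) ^+ #|U| =
  (-1) ^+ #|W| * (S == W)%:R :> R.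
Proof.
have [<-|neSW] := eqVneq S W.
  rewrite mulr1 (bigD1 S) ?subxx //= big1 ?addr0 // => U /andP[].
  by rewrite -eqEsubset eq_sym => ->.
rewrite mulr0; have [sSW|nsSW] := boolP (S \subset W); last first.
  by rewrite big1 // => U /andP[SU UW]; rewrite (subset_trans SU UW) in nsSW.
have /properP[_ [x xW xS]] : S \proper W by rewrite properEneq neSW.
pose toggle U := if x \in U then U :\ x else x |: U.
have toggleK : involutive toggle.
  move=> U; rewrite /toggle; have [xU|xU] := boolP (x \in U).
    by rewrite setD11 setD1K.
  by rewrite setU11 setU1K.
have toggle_interval U : (S \subset U) && (U \subset W) ->
    (S \subset toggle U) && (toggle U \subset W).
  rewrite /toggle => /andP[SU UW]; case: ifP => _.
    by rewrite subsetD1 SU xS (subset_trans _ UW) ?subD1set.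
  by rewrite subUset sub1set xW UW (subset_trans SU) ?subsetUr.
set s := \sum_(U | _) _; suff: s = - s by lra.
rewrite {1}/s (reindex_inj (inv_inj toggleK)) /= -sumrN; apply: eq_big => U.
  apply/idP/idP => [/toggle_interval|]; last exact: toggle_interval.
  by rewrite toggleK.
rewrite /toggle; case: ifP => xU _.
  by rewrite [in RHS](cardsD1 x U) xU exprS mulN1r opprK.
by rewrite cardsU1 xU exprS mulN1r.
Qed.

(** The candidate [w] is the Moebius inverse of [z].  Its value at [S] is
    nonnegative because it is the quadratic form at the polynomial [alpha] that
    interpolates the indicator of [S] on [F].  The monomials of [alpha] outside [F]
    can be dropped: they vanish at all members of [F], because [F] is down-closed. *)
Lemma psd_down_closed_measure (F : pred {set T}) (z : {set T} -> R) :
    (forall S U, S \subset U -> F U -> F S) ->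
    (forall S, ~~ F S -> z S = 0) ->
    (forall alpha : {set T} -> R,
       0 <= \sum_(U | F U) \sum_(V | F V) alpha U * alpha V * z (U :|: V)) ->
  exists w : {set T} -> R, [/\ forall S, 0 <= w S,
    forall S, ~~ F S -> w S = 0
    & forall W, z W = \sum_(S : {set T} | W \subset S) w S].
Proof.
move=> Fdown zF zpsd.
pose w S := \sum_(W : {set T} | S \subset W) (-1) ^+ #|S| * (-1) ^+ #|W| * z W.
have signK k : (-1) ^+ k * (-1) ^+ k = 1 :> R.
  by rewrite -exprMn mulrNN mulr1 expr1n.
have wF S : ~~ F S -> w S = 0.
  move=> nFS; rewrite /w big1 // => W SW; rewrite zF ?mulr0 //.
  by apply: contra nFS; apply: Fdown.
have zE W : z W = \sum_(S : {set T} | W \subset S) w S.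
  rewrite /w (exchange_big_dep (fun V : {set T} => W \subset V)) /=; last first.
    by move=> S V WS SV; apply: subset_trans SV.
  transitivity (\sum_(V : {set T} | W \subset V)
      (-1) ^+ #|V| * z V * ((-1) ^+ #|V| * (W == V)%:R)).
    rewrite (bigD1 W) ?subxx //= eqxx mulr1 mulrAC signK mul1r big1 ?addr0 //.
    by move=> V /andP[_]; rewrite eq_sym => /negPf->; rewrite !mulr0.
  apply: eq_bigr => V WV; rewrite -sum_signs_interval mulr_sumr.
  by apply: eq_bigr => S _; rewrite mulrC mulrA.
clearbody w; exists w; split=> // S; have [FS|/wF->//] := boolP (F S).
pose alpha U : R := if S \subset U then (-1) ^+ #|S| * (-1) ^+ #|U| else 0.
have alphaE W : F W -> \sum_(U | F U && (U \subset W)) alpha U = (S == W)%:R.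
  move=> FW; rewrite /alpha -big_mkcondr /=.
  under eq_bigl => U.
    rewrite (_ : _ && _ = (S \subset U) && (U \subset W)); first over.
    by case: (boolP (U \subset W)) => [/Fdown->//|]; rewrite ?andbF // andbC.
  rewrite -mulr_sumr sum_signs_interval mulrA.
  by have [->|] := eqVneq S W; rewrite ?mulr0 // signK mulr1.
have := zpsd alpha.
suff -> : \sum_(U | F U) \sum_(V | F V) alpha U * alpha V * z (U :|: V) = w S by [].
(* The quadratic form is the integral of the squared polynomial against [w]. *)
transitivity (\sum_(W : {set T}) w W * (\sum_(U | F U && (U \subset W)) alpha U) ^+ 2).
  transitivity (\sum_(U | F U) \sum_(V | F V) \sum_(W : {set T})
      w W * (if U \subset W then alpha U else 0) * (if V \subset W then alpha V else 0)).
    apply: eq_bigr => U _; apply: eq_bigr => V _.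
    rewrite zE mulr_sumr big_mkcond; apply: eq_bigr => W _.
    rewrite subUset; case: (U \subset W); case: (V \subset W);
      rewrite /= ?mulr0 ?mul0r //.
    by rewrite mulrC mulrA.
  under eq_bigr do rewrite exchange_big.
  rewrite exchange_big; apply: eq_bigr => W _ /=.
  rewrite expr2 !big_mkcondr mulr_suml mulr_sumr; apply: eq_bigr => U _.
  by rewrite mulr_sumr mulr_sumr; apply: eq_bigr => V _; rewrite mulrA.
rewrite (bigD1 S) //= alphaE // eqxx expr1n mulr1 big1 ?addr0 // => W neWS.
have [FW|/wF->] := boolP (F W); last by rewrite mul0r.
by rewrite alphaE // eq_sym (negPf neWS) expr0n mulr0.
Qed.
End Moebius.

(** * Bounds on pseudo-moments *)

Section MomentFacts.
Variables (R : realType) (m n d : nat) (A : 'M[R]_(m, n)) (b : 'cV[R]_m).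
Implicit Types (S U V W : {set 'I_n}) (y : {set 'I_n} -> R).

(** Testing with two monomials is enough for all bounds on pseudo-moments. *)
Lemma moment_form_pair y U V (s t : R) : (#|U| <= d)%N -> (#|V| <= d)%N ->
  moment_form d y (fun W => s * (W == U)%:R + t * (W == V)%:R) =
  s ^+ 2 * y U + 2 * s * t * y (U :|: V) + t ^+ 2 * y V.
Proof.
move=> Ud Vd.
have pick (G : {set 'I_n} -> R) W0 : (#|W0| <= d)%N ->
    \sum_(W : {set 'I_n} | (#|W| <= d)%N) (W == W0)%:R * G W = G W0.
  move=> W0d; rewrite (bigD1 W0) //= eqxx mul1r big1 ?addr0 // => W /andP[_ /negPf->].
  by rewrite mul0r.
have pick2 (G : {set 'I_n} -> R) :
    \sum_(W : {set 'I_n} | (#|W| <= d)%N)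
      (s * (W == U)%:R + t * (W == V)%:R) * G W = s * G U + t * G V.
  under eq_bigr do rewrite mulrDl -!mulrA.
  by rewrite big_split /= -!mulr_sumr !pick.
rewrite /moment_form.
under eq_bigr => W _ do (under eq_bigr do rewrite -mulrA; rewrite -mulr_sumr pick2).
by rewrite pick2 !setUid [V :|: U]setUC; ring.
Qed.

Lemma moment_form_single y U : (#|U| <= d)%N ->
  moment_form d y (fun W => 1 * (W == U)%:R + 0 * (W == U)%:R) = y U.
Proof. by move=> Ud; rewrite moment_form_pair // setUid; ring. Qed.

Section Feasible.
Variables (y : {set 'I_n} -> R) (yfeas : moment_feasible d A b y).

Lemma moment_set0 : y set0 = 1.
Proof. by case: yfeas. Qed.

Lemma moment_ge0 S : (#|S| <= d)%N -> 0 <= y S.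
Proof. by move=> Sd; rewrite -moment_form_single //; case: yfeas. Qed.

Lemma moment_setU1_ge0 i S : (#|S| <= d)%N -> 0 <= y (i |: S).
Proof.
case: yfeas => _ _ yX _ Sd.
by rewrite -(moment_form_single (fun S => y (i |: S)) Sd); apply: yX.
Qed.

(** The squares of [x_S + x_V] and [x_S - x_V] bound [2 |y (S :|: V)|] by
    [y S + y V], and the square of [1 - x_U] bounds [y U] by [1]. *)
Lemma moment_setU_norm_le1 S V : (#|S| <= d)%N -> (#|V| <= d)%N ->
  `|y (S :|: V)| <= 1.
Proof.
case: yfeas => y0 ysq _ _.
have le1 U : (#|U| <= d)%N -> y U <= 1.
  move=> Ud; have Od : (#|@set0 'I_n| <= d)%N by rewrite cards0.
  have := ysq (fun W => 1 * (W == U)%:R + -1 * (W == set0)%:R).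
  by rewrite moment_form_pair // setU0 y0; lra.
move=> Sd Vd; have := le1 _ Sd; have := le1 _ Vd.
have := ysq (fun W => 1 * (W == S)%:R + -1 * (W == V)%:R).
have := ysq (fun W => 1 * (W == S)%:R + 1 * (W == V)%:R).
by rewrite !moment_form_pair // ler_norml => *; apply/andP; split; lra.
Qed.

(** The same squares, multiplied by [x_i]. *)
Lemma moment_setU1_norm_le1 i S V : (0 < d)%N -> (#|S| <= d)%N -> (#|V| <= d)%N ->
  `|y (i |: (S :|: V))| <= 1.
Proof.
case: (yfeas) => y0 ysq yX _ d0 Sd Vd.
have le1 U : (#|U| <= d)%N -> y (i |: U) <= 1.
  by move=> Ud; apply: le_trans (ler_norm _) _; rewrite moment_setU_norm_le1 ?cards1.
have := le1 _ Sd; have := le1 _ Vd.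
have := yX i (fun W => 1 * (W == S)%:R + -1 * (W == V)%:R).
have := yX i (fun W => 1 * (W == S)%:R + 1 * (W == V)%:R).
by rewrite !moment_form_pair // ler_norml => *; apply/andP; split; lra.
Qed.

Lemma moment_lp_relaxation : (0 < d)%N -> lp_relaxation A b (\col_i y [set i]).
Proof.
move=> d0; split=> [i|j].
  rewrite mxE moment_ge0 ?cards1 //=; apply: le_trans (ler_norm _) _.
  by rewrite -[[set i]]setU0 moment_setU_norm_le1 ?cards1 ?cards0.
case: yfeas => y0 _ _ yA; rewrite mxE.
have Od : (#|@set0 'I_n| <= d)%N by rewrite cards0.
have := yA j (fun W => 1 * (W == set0)%:R + 0 * (W == set0)%:R).
rewrite (@moment_form_single _ _ Od) y0 mulr1 subr_ge0; apply: le_trans.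
by apply: ler_sum => i _; rewrite mxE setU0.
Qed.

Lemma moment_set1_ge0 i : (0 < d)%N -> 0 <= y [set i].
Proof. by move=> d0; rewrite moment_ge0 ?cards1. Qed.

Hypothesis A_ge0 : forall j i, 0 <= A j i.

(** Multiply the violated row [j] by the square of the monomial of [S]: on [S] the
    row becomes the negative constant [b j - A_j(S)], and the variables outside
    [S] only contribute nonpositive terms. *)
Lemma moment_infeasible S j : (#|S| <= d)%N -> b j 0 < \sum_(i in S) A j i ->
  y S = 0.
Proof.
move=> Sd bS; apply/eqP; rewrite eq_le moment_ge0 // andbT.
case: yfeas => _ _ _ yA.
have := yA j (fun W => 1 * (W == S)%:R + 0 * (W == S)%:R).
rewrite moment_form_single // subr_ge0 => le_b.
have : (\sum_(i in S) A j i) * y S <= b j 0 * y S.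
  apply: le_trans le_b; rewrite mulr_suml [leRHS](bigID (mem S)) /=.
  rewrite -[leLHS]addr0 lerD //.
    by apply: ler_sum => i iS; rewrite (setUidPr _) // sub1set.
  by apply: sumr_ge0 => i _; rewrite mulr_ge0 // moment_setU1_ge0.
by rewrite -subr_ge0 -mulrBl nmulr_rge0 // subr_lt0.
Qed.
End Feasible.

(** The moments of the origin, which is feasible. *)
Lemma moment_feasible_dirac0 : (forall j, 0 <= b j 0) ->
  moment_feasible d A b (fun S => (S == set0)%:R).
Proof.
move=> b0.
have form_ge0 (F : {set 'I_n} -> R) (k : R) alpha : 0 <= k ->
    (forall S, F S = k * (S == set0)%:R) -> 0 <= moment_form d F alpha.
  move=> k0 FE; rewrite /moment_form (bigD1 set0) ?cards0 //= (bigD1 set0) ?cards0 //=.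
  rewrite [X in _ + X]big1 => [|U /andP[_ /negPf U0]]; last first.
    by rewrite big1 // => V _; rewrite FE setU_eq0 U0 !mulr0.
  rewrite [X in _ + X + _]big1 => [|V /andP[_ /negPf V0]]; last first.
    by rewrite FE set0U V0 !mulr0.
  by rewrite !addr0 FE setU0 eqxx mulr1 mulr_ge0 // -expr2 sqr_ge0.
have setU1_neq0 i S : (i |: S == set0) = false.
  by apply/eqP => /setP/(_ i); rewrite !inE eqxx.
split=> [|alpha|i alpha|j alpha]; first by rewrite eqxx.
- by apply: (form_ge0 _ 1) => // S; rewrite mul1r.
- by apply: (form_ge0 _ 0) => // S; rewrite setU1_neq0 mul0r.
- apply: (form_ge0 _ (b j 0)) => // S; rewrite [X in _ - X]big1 ?subr0 // => i _.
  by rewrite setU1_neq0 mulr0.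
Qed.

(** Moments of sets that the relaxation never mentions are arbitrary; setting them
    to zero makes the set of moment vectors bounded without changing [Sol]. *)
Lemma moment_feasible_bounded y : (0 < d)%N -> moment_feasible d A b y ->
  exists z, [/\ moment_feasible d A b z, forall S, `|z S| <= 1
    & forall i, z [set i] = y [set i]].
Proof.
move=> d0 yfeas.
pose occurs S := [exists U : {set 'I_n}, [exists V : {set 'I_n},
  [&& (#|U| <= d)%N, (#|V| <= d)%N
    & (S == U :|: V) || [exists i, S == i |: (U :|: V)]]]].
pose z S := if occurs S then y S else 0.
have zU U V : (#|U| <= d)%N -> (#|V| <= d)%N -> z (U :|: V) = y (U :|: V).
  move=> Ud Vd; rewrite /z ifT //; apply/existsP; exists U; apply/existsP; exists V.
  by rewrite Ud Vd eqxx.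
have zU1 i U V : (#|U| <= d)%N -> (#|V| <= d)%N ->
    z (i |: (U :|: V)) = y (i |: (U :|: V)).
  move=> Ud Vd; rewrite /z ifT //; apply/existsP; exists U; apply/existsP; exists V.
  by rewrite Ud Vd /=; apply/orP; right; apply/existsP; exists i.
have Od : (#|@set0 'I_n| <= d)%N by rewrite cards0.
have eq_form (F G : {set 'I_n} -> R) alpha :
    (forall U V, (#|U| <= d)%N -> (#|V| <= d)%N -> F (U :|: V) = G (U :|: V)) ->
    0 <= moment_form d G alpha -> 0 <= moment_form d F alpha.
  move=> FG; congr (_ <= _); apply: eq_bigr => U Ud; apply: eq_bigr => V Vd.
  by rewrite FG.
exists z; split.
- case: (yfeas) => y0 ysq yX yA; split.
  + by rewrite -[set0]setU0 zU // setU0.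
  + by move=> alpha; apply: eq_form (ysq alpha).
  + by move=> i alpha; apply: eq_form (yX i alpha) => U V Ud Vd; apply: zU1.
  + move=> j alpha; apply: eq_form (yA j alpha) => U V Ud Vd.
    by rewrite zU //; congr (_ - _); apply: eq_bigr => i _; rewrite zU1.
- move=> S; rewrite /z; case: ifP; last by rewrite normr0.
  case/existsP=> U /existsP[V /and3P[Ud Vd /orP[/eqP->|/existsP[i /eqP->]]]].
    by rewrite (moment_setU_norm_le1 yfeas).
  by rewrite (moment_setU1_norm_le1 yfeas).
- by move=> i; rewrite -[[set i]]setU0 zU // cards1.
Qed.
End MomentFacts.

(** * Inequalities with a small right-hand side *)

Section SmallRank.
Variables (R : realType) (m n : nat) (A : 'M[R]_(m, n)) (b : 'cV[R]_m).
Hypothesis A_ge0 : forall j i, 0 <= A j i.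

Definition feasible_set (S : {set 'I_n}) : bool :=
  [forall j, \sum_(i in S) A j i <= b j 0].

Lemma feasible_setS (S U : {set 'I_n}) : S \subset U -> feasible_set U -> feasible_set S.
Proof.
move=> SU /forallP FU; apply/forallP => j; apply: le_trans (FU j).
rewrite [leRHS](big_setID S) /= (setIidPr SU) lerDl.
by apply: sumr_ge0 => i _.
Qed.

(** The relaxation is exact for an inequality that bounds the number of ones in
    its support.  The family [F] of feasible subsets of that support is
    down-closed and consists of sets of size at most [f]. *)
Lemma moment_small_rank (d f : nat) (a : 'I_n -> nat) (y : {set 'I_n} -> R) :
    (forall S, feasible_set S -> (\sum_(i in S) a i <= f)%N) ->
    (2 * f + 1 <= d)%N -> moment_feasible d A b y ->
  \sum_i (a i)%:R * y [set i] <= f%:R.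
Proof.
move=> aP fd yfeas.
pose N := [set i | a i != 0%N].
pose F (S : {set 'I_n}) := (S \subset N) && feasible_set S.
pose z (S : {set 'I_n}) := if F S then y S else 0.
have Fcard S : F S -> (#|S| <= f)%N.
  case/andP=> /subsetP SN FS; apply: leq_trans (aP S FS).
  by rewrite -sum1_card leq_sum // => i /SN; rewrite inE lt0n.
(* A subset of the support outside [F] is infeasible: its moment is zero anyway. *)
have zE (S : {set 'I_n}) : S \subset N -> (#|S| <= d)%N -> z S = y S.
  rewrite /z /F => -> Sd /=; case: ifPn => // /forallPn[j]; rewrite -ltNge => bS.
  by rewrite (moment_infeasible yfeas A_ge0 Sd bS).
have [||alpha|w [w_ge0 wF zw]] := @psd_down_closed_measure R _ F z.
- move=> S U SU /andP[UN FU].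
  by rewrite /F (subset_trans SU UN) (feasible_setS SU FU).
- by move=> S nFS; rewrite /z (negPf nFS).
- case: (yfeas) => _ /(_ (fun S => if F S then alpha S else 0)) + _ _; congr (_ <= _).
  have Fd S : F S -> (#|S| <= d)%N by move=> /Fcard; lia.
  rewrite /moment_form [LHS]big_mkcond [RHS]big_mkcond.
  apply: eq_bigr => U _; case: (boolP (F U)) => FU; last first.
    by case: ifP => // _; rewrite big1 // => V _; rewrite !mul0r.
  rewrite Fd // [LHS]big_mkcond [RHS]big_mkcond; apply: eq_bigr => V _ /=.
  case: (boolP (F V)) => FV; last by rewrite mulr0 mul0r if_same.
  rewrite Fd // zE //; first by rewrite subUset; case/andP: FU => ->; case/andP: FV.
  by apply: leq_trans (leq_card_setU _ _) _; move: (Fcard _ FU) (Fcard _ FV); lia.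
have z0 : z set0 = 1.
  by rewrite zE ?sub0set ?cards0 // (moment_set0 yfeas).
have -> : \sum_i (a i)%:R * y [set i] = \sum_S w S * (\sum_(i in S) a i)%:R.
  transitivity (\sum_i \sum_(S : {set 'I_n} | i \in S) (a i)%:R * w S).
    apply: eq_bigr => i _; have [->|ai] := eqVneq (a i) 0%N.
      by rewrite mul0r big1 // => S _; rewrite mul0r.
    rewrite -zE ?cards1 ?sub1set ?inE //; last by lia.
    by rewrite zw mulr_sumr; apply: eq_bigl => S; rewrite sub1set.
  rewrite (exchange_big_dep xpredT) //=; apply: eq_bigr => S _.
  by rewrite natr_sum mulr_sumr; apply: eq_bigr => i _; rewrite mulrC.
have <- : \sum_S w S * f%:R = f%:R.
  rewrite -mulr_suml -[RHS]mul1r -z0 zw; congr (_ * _).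
  by apply: eq_bigl => S; rewrite sub0set.
apply: ler_sum => S _; have [/andP[_ FS]|/wF->] := boolP (F S); last by rewrite !mul0r.
by rewrite ler_wpM2l // ler_nat aP.
Qed.
End SmallRank.

(** * Chvatal-Gomory closures of a packing polytope *)

Section Packing.
Variable R : realType.

Definition nonneg n (X : classical_sets.set 'cV[R]_n) : Prop :=
  forall x, X x -> forall i, 0 <= x i 0.

Definition down_closed n (X : classical_sets.set 'cV[R]_n) : Prop :=
  forall x x' : 'cV[R]_n, X x -> (forall i, 0 <= x' i 0 <= x i 0) -> X x'.

Definition pos_part n (a : 'cV[int]_n) : 'cV[int]_n := \col_i Num.max (a i 0) 0.

(** Zeroing the coordinates of [z] where [a] is negative stays in [X], and turns
    the value of the positive part of [a] at [z] into a value of [a]. *)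
Lemma dot_pos_part_le n (X : classical_sets.set 'cV[R]_n) (a : 'cV[int]_n) (a0 : R) :
    nonneg X -> down_closed X ->
    (forall z, X z -> dot (map_mx intr a) z <= a0) ->
  forall z, X z -> dot (map_mx intr (pos_part a)) z <= a0.
Proof.
move=> X0 Xdown aX z Xz.
pose z' : 'cV[R]_n := \col_i (if 0 <= a i 0 then z i 0 else 0).
have /aX : X z'.
  apply: (Xdown z) => // i; rewrite mxE; have zi := X0 _ Xz i.
  by case: ifP; rewrite ?lexx zi.
congr (_ <= _); apply: eq_bigr => i _; rewrite !mxE.
by case: ifPn => ai; [rewrite max_l | rewrite max_r ?mul0r ?mulr0 // ltW // ltNge].
Qed.

Lemma dot_le_pos_part n (a : 'cV[int]_n) (x : 'cV[R]_n) : (forall i, 0 <= x i 0) ->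
  dot (map_mx intr a) x <= dot (map_mx intr (pos_part a)) x.
Proof.
move=> x0; apply: ler_sum => i _; rewrite !mxE ler_wpM2r // ler_int.
by rewrite le_max lexx.
Qed.

Lemma dot_pos_part_mono n (a : 'cV[int]_n) (x x' : 'cV[R]_n) :
  (forall i, x' i 0 <= x i 0) ->
  dot (map_mx intr (pos_part a)) x' <= dot (map_mx intr (pos_part a)) x.
Proof.
move=> le_x; apply: ler_sum => i _; rewrite !mxE ler_wpM2l // ler0z.
by rewrite le_max lexx orbT.
Qed.

(** The cut given by the positive part of [a] is monotone in the point, and it
    implies the cut given by [a] on nonnegative points. *)
Lemma cg_closure_down_closed n (X : classical_sets.set 'cV[R]_n) :
  nonneg X -> down_closed X -> down_closed (cg_closure X).
Proof.
move=> X0 Xdown x x' [Xx cgx] le_x; split=> [|a a0 aX]; first exact: Xdown le_x.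
apply: le_trans (dot_le_pos_part a _) _; first by move=> i; case/andP: (le_x i).
apply: le_trans (cgx _ _ (dot_pos_part_le X0 Xdown aX)).
by apply: dot_pos_part_mono => i; case/andP: (le_x i).
Qed.

Lemma cg_closure_int n (X : classical_sets.set 'cV[R]_n) (z : 'cV[int]_n) :
  X (map_mx intr z) -> cg_closure X (map_mx intr z).
Proof.
move=> Xz; split=> // a a0 /(_ _ Xz).
have -> : dot (map_mx intr a) (map_mx intr z) = (\sum_i a i 0 * z i 0)%:~R :> R.
  by rewrite rmorph_sum; apply: eq_bigr => i _; rewrite !mxE -intrM.
by rewrite ler_int floor_ge_int.
Qed.

Variables (m n : nat) (A : 'M[R]_(m, n)) (b : 'cV[R]_m).
Let P t := cg_closure_iter t (lp_relaxation A b).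

Lemma cg_closure_iter_sub t x : P t x -> lp_relaxation A b x.
Proof. by elim: t => // t IHt [/IHt]. Qed.

Lemma cg_closure_iter_nonneg t : nonneg (P t).
Proof. by move=> x /cg_closure_iter_sub[x01 _] i; case/andP: (x01 i). Qed.

Hypothesis A_ge0 : forall j i, 0 <= A j i.
Hypothesis b_ge0 : forall j, 0 <= b j 0.

Lemma cg_closure_iter_down_closed t : down_closed (P t).
Proof.
elim: t => [x x' [x01 Ax] le_x|t IHt].
  split=> [i|j].
    by case/andP: (le_x i) => -> /le_trans -> //; case/andP: (x01 i).
  apply: le_trans (Ax j); rewrite !mxE; apply: ler_sum => i _.
  by rewrite ler_wpM2l //; case/andP: (le_x i).
exact: cg_closure_down_closed (@cg_closure_iter_nonneg t) IHt.
Qed.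

(** The left-hand side of a cut is an integer at a 0/1 point, so no round of
    rounding removes the point. *)
Lemma cg_closure_iter_indicator t (S : {set 'I_n}) :
  feasible_set A b S -> P t (\col_i (i \in S)%:R).
Proof.
move=> FS; rewrite (_ : \col_i _ = map_mx intr (\col_i (i \in S : int))); last first.
  by apply/matrixP=> i j; rewrite !mxE; case: (i \in S).
elim: t => [|t IHt]; last exact: cg_closure_int.
split=> [i|j]; first by rewrite !mxE; case: (i \in S); rewrite !lexx ler01.
move/forallP: FS => /(_ j); apply: le_trans.
rewrite mxE [leRHS]big_mkcond; apply: ler_sum => i _ /=.
by rewrite !mxE; case: (i \in S); rewrite ?mulr1 ?mulr0.
Qed.

Lemma feasible_set0 : feasible_set A b set0.
Proof. by apply/forallP=> j; rewrite big_set0. Qed.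

Lemma cg_closure_iter_0 t : P t 0.
Proof.
rewrite (_ : 0 = \col_i (i \in (set0 : {set 'I_n}))%:R); last first.
  by apply/matrixP=> i j; rewrite !mxE inE.
exact/cg_closure_iter_indicator/feasible_set0.
Qed.
End Packing.

(** * The scaled relaxation satisfies all Chvatal-Gomory cuts *)

(** Quantifying over all large [d], rather than for a single one, lets the
    induction combine its two requirements on the degree. *)
Lemma moments_scaled_cg (R : realType) (t : nat) (delta : R) : 0 < delta ->
  exists D : nat, forall (d m n : nat) (A : 'M[R]_(m, n)) (b : 'cV[R]_m) y,
    (D <= d)%N -> (forall j i, 0 <= A j i) -> (forall j, 0 <= b j 0) ->
    moment_feasible d A b y ->
    cg_closure_iter t (lp_relaxation A b) ((1 + delta)^-1 *: \col_i y [set i]).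
Proof.
have scale (dl r : R) : 0 < dl -> 0 <= r -> 0 <= (1 + dl)^-1 * r <= r.
  move=> dl0 r0; rewrite mulr_ge0 ?invr_ge0 //=; last lra.
  by rewrite ler_piMl // invf_le1; lra.
elim: t delta => [|t IHt] delta delta0.
  exists 1%N => d m n A b y d0 A0 b0 yfeas.
  apply: (@cg_closure_iter_down_closed _ _ _ A b A0 0%N (\col_i y [set i])).
    exact: moment_lp_relaxation yfeas d0.
  by move=> i; rewrite !mxE scale // (moment_set1_ge0 yfeas).
have [|D IHD] := IHt (delta / 2); first lra.
(* For [f >= K], [(1 + delta / 2) * (f + 1) <= (1 + delta) * f]. *)
pose K := (Num.trunc ((2 + delta) / delta)).+1.
exists (maxn D (2 * K + 1)) => d m n A b y.
rewrite geq_max => /andP[Dd Kd] A0 b0 yfeas.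
set x := \col_i y [set i].
have d0 : (0 < d)%N by lia.
have y0 i : 0 <= y [set i] by apply: moment_set1_ge0 yfeas i d0.
have Pdown := @cg_closure_iter_down_closed _ _ _ A b A0 t.
have Pnn := @cg_closure_iter_nonneg _ _ _ A b t.
have xP := IHD _ _ _ A b y Dd A0 b0 yfeas.
split=> [|a a0 aP].
  apply: Pdown xP _ => i; rewrite !mxE.
  rewrite mulr_ge0 ?invr_ge0 //=; last lra.
  by rewrite ler_wpM2r // lef_pV2 ?posrE; lra.
have {}aP := dot_pos_part_le Pnn Pdown aP.
apply: le_trans (dot_le_pos_part a _) _.
  by move=> i; rewrite !mxE; case/andP: (scale _ _ delta0 (y0 i)).
have apE i : (map_mx intr (pos_part a) : 'cV[R]_n) i 0 = `|pos_part a i ord0|%N%:R.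
  by rewrite !mxE natr_absz ger0_norm // le_max lexx orbT.
move: {a} (pos_part a) aP apE => a aP aE.
have dotZ k (v : 'cV[R]_n) : dot (map_mx intr a) (k *: v) = k * dot (map_mx intr a) v.
  by rewrite /dot mulr_sumr; apply: eq_bigr => i _; rewrite [X in _ * X]mxE mulrCA.
have a0_ge0 : 0 <= a0.
  apply: le_trans (aP _ (cg_closure_iter_0 A b0 t)).
  by rewrite /dot big1 // => i _; rewrite [X in _ * X]mxE mulr0.
have := floor_itv a0; have : 0 <= Num.floor a0 by rewrite floor_ge_int.
case: (Num.floor a0) => // f _; rewrite intrD -!pmulrn => /andP[fa0 a0f].
rewrite dotZ ler_pdivrMl; last lra.
have [fK|Kf] := ltnP f K.
  have -> : dot (map_mx intr a) x = \sum_i `|a i ord0|%N%:R * y [set i].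
    by apply: eq_bigr => i _; rewrite aE mxE.
  apply: (@le_trans _ _ f%:R); last by rewrite ler_peMl // lerDl ltW.
  apply: (moment_small_rank A0 _ _ yfeas) => [S FS|]; last lia.
  have := aP _ (cg_closure_iter_indicator t FS).
  have -> : dot (map_mx intr a) (\col_i (i \in S)%:R) =
      (\sum_(i in S) `|a i ord0|%N)%:R :> R.
    rewrite natr_sum [RHS]big_mkcond; apply: eq_bigr => i _.
    by rewrite aE mxE; case: (i \in S); rewrite ?mulr1 ?mulr0.
  by rewrite -ltnS -(ltr_nat R) -natr1 => /le_lt_trans; apply.
have := aP _ xP; rewrite dotZ ler_pdivrMl => [xa0|]; last lra.
apply: le_trans xa0 _.
have : (2 + delta) / delta < f%:R.
  apply: (@lt_le_trans _ _ K%:R); last by rewrite ler_nat.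
  by rewrite -truncn_lt_nat // divr_ge0; lra.
by rewrite ltr_pdivrMr // => fdelta; nra.
Qed.

(** * Attainment of the maxima *)

Section Compactness.
Import classical_sets topology normedtype numFieldNormedType.Exports ArrowAsProduct.
Local Open Scope classical_set_scope.
Local Open Scope ring_scope.
Variable R : realType.

Lemma closed_nonneg (T : topologicalType) (f : T -> R) :
  continuous f -> closed [set x | 0 <= f x].
Proof.
move=> fcont; apply: (@preimage_closed _ _ f [set r | 0 <= r]).
  by move=> x _; apply: fcont.
exact: closed_ge.
Qed.

Lemma closed_forall (T : topologicalType) (K : Type) (P : K -> set T) :
  (forall k, closed (P k)) -> closed [set x | forall k, P k x].
Proof.
move=> Pcl; rewrite (_ : [set x | _] = \bigcap_k P k); first exact: closed_bigI.
by apply/seteqP; split=> x Px k => [_|]; apply: Px.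
Qed.

Lemma continuous_sum (T : topologicalType) (I : Type) (r : seq I) (P : pred I)
    (F : I -> T -> R) : (forall i, continuous (F i)) ->
  continuous (fun x => \sum_(i <- r | P i) F i x).
Proof.
by move=> Fcont; apply: continuous_big => [x|i _]; [apply: add_continuous | apply: Fcont].
Qed.

Lemma continuousMl (T : topologicalType) (k : R) (f : T -> R) :
  continuous f -> continuous (fun x => k * f x).
Proof. by move=> fcont x; apply: continuousM; [apply: cst_continuous | apply: fcont]. Qed.

Lemma continuous_coord (I : eqType) (i : I) : continuous (fun v : I -> R => v i).
Proof. by move=> v; apply: (@proj_continuous I (fun=> R) i). Qed.

(** The box containing [Y] is compact for pointwise convergence by Tychonoff's
    theorem. *)
Lemma max_attained (I : eqType) (Y : set (I -> R)) (B : R) (f : (I -> R) -> R) :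
  Y !=set0 -> closed Y -> (forall v, Y v -> forall i, `|v i| <= B) ->
  continuous f -> exists2 v, Y v & forall w, Y w -> f w <= f v.
Proof.
move=> Y0 Ycl YB fcont.
have Ycompact : compact Y.
  apply: (@subclosed_compact _ _ [set v : I -> R | forall i, v i \in `[- B, B]]) => //.
    exact: (@tychonoff I (fun=> R) (fun=> [set` `[- B, B]])
      (fun=> @segment_compact _ _ _)).
  by move=> v Yv i; rewrite in_itv /= -ler_norml; apply: YB.
have fYcompact : compact (f @` Y).
  by apply: continuous_compact => //; apply: continuous_subspaceT.
have fY0 : f @` Y !=set0 by case: Y0 => v Yv; exists (f v), v.
have fYsup := compact_has_sup fY0 fYcompact.
have [v Yv fv] : (f @` Y) (sup (f @` Y)).
  rewrite [X in X _](closure_id _).1; first by case: fYsup; apply: closure_sup.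
  exact: compact_closed (@Rhausdorff R) fYcompact.
by exists v => // w Yw; rewrite fv; apply: sup_upper_bound => //; exists w.
Qed.

Lemma continuous_dot_coords n (c : 'cV[R]_n) (I : eqType) (e : 'I_n -> I) :
  continuous (fun v : I -> R => dot c (\col_i v (e i))).
Proof.
rewrite (_ : (fun v => _) = (fun v : I -> R => \sum_i c i 0 * v (e i))).
  by apply: continuous_sum => i; apply/continuousMl/continuous_coord.
by apply/funext=> v; apply: eq_bigr => i _; rewrite mxE.
Qed.

Lemma closed_le_cst (T : topologicalType) (f : T -> R) (k : R) :
  continuous f -> closed (fun x => f x <= k).
Proof.
move=> fcont; apply: (@preimage_closed _ _ f (fun r => r <= k)).
  by move=> x _; apply: fcont.
exact: closed_le.
Qed.

Lemma closed_nonneg_forms (T : topologicalType) (K : Type) (f : K -> T -> R) :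
  (forall k, continuous (f k)) -> closed (fun x => forall k, 0 <= f k x).
Proof. by move=> fcont; apply: closed_forall => k; apply: closed_nonneg. Qed.

Lemma continuous_moment_form (T : topologicalType) n d
    (F : T -> {set 'I_n} -> R) (alpha : {set 'I_n} -> R) :
  (forall S, continuous (fun x => F x S)) ->
  continuous (fun x => moment_form d (F x) alpha).
Proof.
move=> Fcont; apply: continuous_sum => U; apply: continuous_sum => V.
by apply: continuousMl.
Qed.

Lemma continuous_sub (T : topologicalType) (f g : T -> R) :
  continuous f -> continuous g -> continuous (fun x => f x - g x).
Proof. by move=> fcont gcont x; apply: continuousB; [apply: fcont | apply: gcont]. Qed.

Lemma closed_moment_feasible m n d (A : 'M[R]_(m, n)) (b : 'cV[R]_m) :
  closed (moment_feasible d A b : set ({set 'I_n} -> R)).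
Proof.
pose fsq alpha (y : {set 'I_n} -> R) := moment_form d y alpha.
pose fX (k : 'I_n * ({set 'I_n} -> R)) (y : {set 'I_n} -> R) :=
  moment_form d (fun S => y (k.1 |: S)) k.2.
pose fA (k : 'I_m * ({set 'I_n} -> R)) (y : {set 'I_n} -> R) :=
  moment_form d (fun S => b k.1 0 * y S - \sum_i A k.1 i * y (i |: S)) k.2.
pose nn K (f : K -> ({set 'I_n} -> R) -> R) y := forall k, 0 <= f k y.
have -> : (moment_feasible d A b : set ({set 'I_n} -> R)) =
    ((fun y => y finset.set0 = 1) `&` nn _ fsq) `&` (nn _ fX `&` nn _ fA).
  apply/seteqP; split=> y.
    by case=> y0 ysq yX yA; split; split=> //; case.
  case=> -[y0 ysq] [yX yA]; split=> //.
  - by move=> i alpha; apply: (yX (i, alpha)).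
  - by move=> j alpha; apply: (yA (j, alpha)).
have coord := @continuous_coord {set 'I_n}.
apply: closedI; apply: closedI; last 3 first.
- apply: closed_nonneg_forms => k.
  by apply: continuous_moment_form => S; apply: coord.
- apply: closed_nonneg_forms => k.
  by apply: continuous_moment_form => S; apply: coord.
- apply: closed_nonneg_forms => k; apply: continuous_moment_form => S.
  apply: continuous_sub; first exact/continuousMl/coord.
  by apply: continuous_sum => i; apply/continuousMl/coord.
apply: (@preimage_closed _ _ (fun y : {set 'I_n} -> R => y finset.set0) (fun r => r = 1)).
  by move=> y _; apply: coord.
exact: closed_eq.
Qed.

Lemma closed_cg_closure n (X : set 'cV[R]_n) :
  closed (fun v : 'I_n -> R => X (\col_i v i)) ->
  closed (fun v : 'I_n -> R => cg_closure X (\col_i v i)).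
Proof.
move=> Xcl; apply: closedI => //; apply: closed_forall => a.
apply: closed_forall => a0; apply: closed_forall => aX.
exact/closed_le_cst/continuous_dot_coords.
Qed.

Lemma closed_lp_relaxation m n (A : 'M[R]_(m, n)) (b : 'cV[R]_m) :
  closed (fun v : 'I_n -> R => lp_relaxation A b (\col_i v i)).
Proof.
apply: closedI; apply: closed_forall => k.
  rewrite [X in closed X](_ : _ = (fun v => 0 <= v k) `&` (fun v => v k <= 1)).
    by apply: closedI; [apply: closed_nonneg | apply: closed_le_cst];
      apply: continuous_coord.
  by apply/seteqP; split=> v; rewrite /= mxE => /andP.
apply: closed_le_cst.
rewrite (_ : (fun v => _) = (fun v : 'I_n -> R => dot (\col_i A k i) (\col_i v i))).
  exact: continuous_dot_coords.
by apply/funext=> v; rewrite mxE; apply: eq_bigr => i _; rewrite !mxE.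
Qed.

Lemma cg_closure_iter_opt m n t (A : 'M[R]_(m, n)) (b : 'cV[R]_m) (c : 'cV[R]_n) :
  (forall j, 0 <= b j 0) ->
  exists opt, is_opt (cg_closure_iter t (lp_relaxation A b)) c opt.
Proof.
move=> b0; pose P := cg_closure_iter t (lp_relaxation A b).
have colE (x : 'cV[R]_n) : \col_i x i 0 = x.
  by apply/matrixP=> i j; rewrite mxE ord1.
have [||v Pv|v|v Pv vmax] := @max_attained 'I_n (fun v => P (\col_i v i)) 1
    (fun v => dot c (\col_i v i)).
- exists (fun=> 0); rewrite (_ : \col_i 0 = 0); first exact: cg_closure_iter_0.
  by apply/matrixP=> i j; rewrite !mxE.
- rewrite /P; elim: (t) => [|t' IHt]; first exact: closed_lp_relaxation.
  exact: closed_cg_closure.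
- move=> i; have [/(_ i)] := cg_closure_iter_sub Pv.
  by rewrite mxE => /andP[v0 v1] _; rewrite ger0_norm.
- exact: continuous_dot_coords.
exists (dot c (\col_i v i)); split; first by exists (\col_i v i).
by move=> _ [x Px <-]; rewrite -[x]colE; apply: vmax; rewrite /= colE.
Qed.

Lemma Sol_opt m n d (A : 'M[R]_(m, n)) (b : 'cV[R]_m) (c : 'cV[R]_n) :
  (0 < d)%N -> (forall j, 0 <= b j 0) -> exists opt, is_opt (Sol d A b) c opt.
Proof.
move=> d0 b0.
pose Y := (moment_feasible d A b : set ({set 'I_n} -> R)) `&`
  (fun y => forall S, `|y S| <= 1).
have [||y [_ ybd]|y|y [yfeas _] ymax] := @max_attained {set 'I_n} Y 1
    (fun y => dot c (\col_i y (finset.set1 i))).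
- exists (fun S => (S == finset.set0)%:R); split; first exact: moment_feasible_dirac0.
  by move=> S; case: eqP; rewrite ?normr1 ?normr0.
- apply: closedI; first exact: closed_moment_feasible.
  apply: closed_forall => S; apply: closed_le_cst => y.
  by apply: continuous_comp; [apply: continuous_coord | apply: norm_continuous].
- exact: ybd.
- exact: continuous_dot_coords.
exists (dot c (\col_i y (finset.set1 i))); split.
  by exists (\col_i y (finset.set1 i)) => //; apply/SolP; exists y.
move=> _ [_ /SolP[z zfeas ->] <-].
have [z' [z'feas z'bd z'z]] := moment_feasible_bounded d0 zfeas.
rewrite (_ : \col_i z (finset.set1 i) = \col_i z' (finset.set1 i)); first exact: ymax.
by apply/matrixP=> i j; rewrite !mxE z'z.
Qed.
End Compactness.

(** * The comparison of optima *)

Theorem theorem6p2 (R : realType) (t : nat) (eps : R) (heps : 0 < eps) :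
  exists d : nat,
    forall (m n : nat) (A : 'M[R]_(m, n)) (b : 'cV[R]_m),
      (forall j i, 0 <= A j i) -> (forall j, 0 <= b j 0) ->
      forall c : 'cV[R]_n, (forall i, 0 <= c i 0) ->
        exists opt_d opt_t : R,
          [/\ is_opt (Sol d A b) c opt_d,
              is_opt (cg_closure_iter t (lp_relaxation A b)) c opt_t
            & opt_d <= (1 + eps) * opt_t].
Proof.
have [D DP] := moments_scaled_cg t heps.
exists D.+1 => m n A b A0 b0 c _.
have [opt_d optd] := @Sol_opt R m n D.+1 A b c isT b0.
have [opt_t optt] := @cg_closure_iter_opt R m n t A b c b0.
exists opt_d, opt_t; split=> //.
case: optd => -[_ /SolP[y yfeas ->] <-] _.
have Py := DP _ _ _ A b y (leqnSn D) A0 b0 yfeas.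
have : dot c ((1 + eps)^-1 *: \col_i y [set i]) <= opt_t.
  by apply: optt.2; eexists; first exact: Py.
have -> : dot c ((1 + eps)^-1 *: \col_i y [set i]) =
    (1 + eps)^-1 * dot c (\col_i y [set i]).
  by rewrite /dot mulr_sumr; apply: eq_bigr => i _; rewrite [X in _ * X]mxE mulrCA.
by rewrite ler_pdivrMl // addr_gt0.
Qed.
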